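(* Let $n\ge 2$ be an integer and let $A\subseteq\mathbb{F}_{2^{n-1}}\setminus\{0\}$ with $|A|=k\ge 3$ and $r(A)>0$. Then there exists a subset of $\mathbb{F}_{2^n}\setminus\{0\}$ of size $k+3$ whose $r$-value is $r(A)+18$.
   Context: For a subset $X$ of a finite additive abelian group, the $r$-value $r(X)$ is the number of ordered pairs $(x,y)\in X\times X$ with $x+y\in X$. Only the additive group of $\mathbb{F}_{2^n}$ is used: its elements are written as vectors $[\alpha_1,\dots,\alpha_n]$ with $\alpha_i\in\{0,1\}$ and addition coordinatewise modulo 2. By convention $\mathbb{F}_{2^{n-1}}$ is regarded as the subset of $\mathbb{F}_{2^n}$ consisting of the vectors with first coordinate $\alpha_1=0$. *)

(* Defs.v *)
From mathcomp Require Import all_boot all_order all_algebra.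

Set Implicit Arguments.
Unset Strict Implicit.
Unset Printing Implicit Defensive.

Import GRing.Theory.
Local Open Scope ring_scope.

Definition rvalue (G : finZmodType) (X : {set G}) : nat :=
  #|[set p in setX X X | p.1 + p.2 \in X]|.

(* Additive group of the field with 2 ^ n elements, in coordinates. *)
Notation F2pow n := 'rV['F_2]_n.

(* The copy of [F2pow n.-1] inside [F2pow n]: first coordinate zero. The
   condition at index 0 is quantified because ['I_n] has a canonical [ord0]
   only when [n] is syntactically a successor. *)
Definition F2pow_pred (n : nat) : {set F2pow n} :=
  [set v : F2pow n | [forall i : 'I_n, (val i == 0%N) ==> (v 0 i == 0)]].

(* Main.v *)
Require Import Defs.
From mathcomp Require Import all_boot all_order all_algebra.

Set Implicit Arguments.
Unset Strict Implicit.
Unset Printing Implicit Defensive.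

Import GRing.Theory.
Local Open Scope ring_scope.

(** Let [H] be the hyperplane of vectors with first coordinate zero. As
    [rvalue A] is positive, [A] contains [x], [y] and [x + y]. The set [B] is
    [A] together with three points [e], [e + x], [e + y] outside [H], whose
    pairwise sums are exactly [x], [y], [x + y].

    In characteristic 2 the value [rvalue X] counts the ordered pairs that
    extend to a triple of elements of [X] with sum zero. Such a triple in [B]
    has an even number of entries outside [H]: either it lies in [A], or it
    consists of two new points and their sum, which must be in [A]. Two equal
    new points have sum 0, which is not in [A]; two distinct ones do have their
    sum in [A]. Hence an ordered triple with entries outside [H] is determined
    by the position of its entry in [A] (3 choices) and by the ordered pair of
    distinct new points in the other positions (6 choices), so there are
    3 * 6 = 18 new pairs. The count for an arbitrary number of new points is
    [rvalueU_odd]. *)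

Definition offdiag (T : finType) (S : {set T}) : {set T * T} :=
  [set p in setX S S | p.1 != p.2].

Lemma card_offdiag (T : finType) (S : {set T}) :
  #|offdiag S| = (#|S| * #|S|.-1)%N.
Proof.
have diagE : setX S S :\: offdiag S = [set (s, s) | s in S].
  apply/setP=> -[a b]; rewrite !inE /=; apply/idP/imsetP.
    case: eqVneq => [->|_]; first by case/andP=> _ /andP[Sb _]; exists b.
    by rewrite andbT => /andP[/negP].
  by case=> s Ss [-> ->]; rewrite Ss eqxx.
have sub : offdiag S \subset setX S S.
  by apply/subsetP=> p; rewrite inE => /andP[].
have := cardsID (offdiag S) (setX S S).
rewrite diagE cardsX (setIidPr sub) card_imset; last by move=> s t [].
by move/(canRL (addnK _)) ->; rewrite -subn1 mulnBr muln1.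
Qed.

(** The parity [f] plays the role of a linear form over the field with two
    elements: [A] lies in its kernel and [S] in the other coset. The values of
    [f] at [x] and [y] split the pairs [(x, y)] into four classes, and
    additivity decides in each class whether [x + y] must lie in [A] or in [S].
    The even-even class gives [rvalue A]; each of the other three is in
    bijection with the pairs of distinct elements of [S]. *)
Lemma rvalueU_odd (G : finZmodType) (f : G -> bool) (A S : {set G}) :
    (forall x : G, x + x = 0) -> {morph f : x y / x + y >-> x (+) y} ->
    0 \notin A -> {in A, forall a, ~~ f a} -> {in S, forall s, f s} ->
    {in S &, forall s t, s != t -> s + t \in A} ->
  rvalue (A :|: S) = (rvalue A + 3 * (#|S| * #|S|.-1))%N.
Proof.
move=> addxx fD A0 fA fS SA.
have addKx (x y : G) : x + (x + y) = y by rewrite addrA addxx add0r.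
have addxK (x y : G) : x + y + y = x by rewrite -addrA addxx addr0.
have inU x : (x \in A :|: S) = if f x then x \in S else x \in A.
  rewrite inE; case: ifP => fx.
    by case: (boolP (x \in A)) => // /fA; rewrite fx.
  by case: (boolP (x \in S)) => [/fS|]; rewrite ?fx ?orbF.
have inSf x : x \in S -> f x = true by move/fS.
have inAf x : x \in A -> f x = false by move/fA/negbTE.
have addS s t : s \in S -> t \in S -> (s + t \in A) = (s != t).
  move=> Ss St; case: eqVneq => [->|]; last exact: SA.
  by rewrite addxx (negbTE A0).
pose D := offdiag S.
pose T := [set p in setX (A :|: S) (A :|: S) | p.1 + p.2 \in A :|: S].
pose F1 := [set p : G * G | f p.1]; pose F2 := [set p : G * G | f p.2].
have inT p : (p \in T) = [&& p.1 \in A :|: S, p.2 \in A :|: S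
                           & p.1 + p.2 \in A :|: S].
  by case: p => a b; rewrite [LHS]inE in_setX andbA.
have T11 : T :&: F1 :&: F2 = D.
  apply/setP=> -[a b]; rewrite in_setI in_setI inT !inU fD !inE /=.
  apply/idP/idP.
    case/andP=> /andP[+ fa] fb; rewrite fa fb /=.
    by case/and3P=> Sa Sb; rewrite Sa Sb addS.
  by case/andP=> /andP[Sa Sb] ab; rewrite !inSf //= Sa Sb addS // ab.
(* In a mixed pair both the odd entry and the sum lie in [S]; these two elements
   are distinct and determine the pair, their own sum being its even entry. *)
have T10 : (T :&: F1) :\: F2 = [set (p.1, p.1 + p.2) | p in D].
  apply/setP=> -[a b]; rewrite in_setD in_setI inT !inU fD !inE /=.
  apply/idP/imsetP.
    case/and3P=> /negbTE fb + fa; rewrite fa fb /= => /and3P[Sa Ab Sab].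
    exists (a, a + b); rewrite /= ?addKx // !inE /= Sa Sab /=.
    by rewrite -addS // addKx.
  case=> -[s t]; rewrite !inE /= => /andP[/andP[Ss St] st] [-> ->].
  by rewrite fD !inSf //= addKx Ss St addS // st.
have T01 : (T :\: F1) :&: F2 = [set (p.1 + p.2, p.2) | p in D].
  apply/setP=> -[a b]; rewrite in_setI in_setD inT !inU fD !inE /=.
  apply/idP/imsetP.
    case/andP=> /andP[/negbTE fa +] fb; rewrite fa fb /= => /and3P[Aa Sb Sab].
    exists (a + b, b); rewrite /= ?addxK // !inE /= Sb Sab /=.
    by rewrite -addS // addxK.
  case=> -[s t]; rewrite !inE /= => /andP[/andP[Ss St] st] [-> ->].
  by rewrite fD !inSf //= addxK Ss St addS // st.
have T00 : (T :\: F1) :\: F2 = [set p in setX A A | p.1 + p.2 \in A].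
  apply/setP=> -[a b]; rewrite in_setD in_setD inT !inU fD !inE /=.
  apply/idP/idP.
    case/and3P=> /negbTE fb /negbTE fa; rewrite fa fb /=.
    by case/and3P=> -> -> ->.
  by case/andP=> /andP[Aa Ab] Aab; rewrite !inAf //= Aa Ab Aab.
have inj10 : injective (fun p : G * G => (p.1, p.1 + p.2)).
  by move=> [s t] [s' t'] [-> /addrI ->].
have inj01 : injective (fun p : G * G => (p.1 + p.2, p.2)).
  by move=> [s t] [s' t'] [st tE]; rewrite tE in st *; rewrite (addIr _ st).
rewrite /rvalue -/T -(cardsID F1 T) -(cardsID F2 (T :&: F1)).
rewrite -(cardsID F2 (T :\: F1)) T11 T10 T01 T00 !card_imset //.
by rewrite -card_offdiag -/D !mulSn mul0n addn0 addnA addnC !addnA.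
Qed.

Theorem proposition4p5 (n k : nat) (hn : (2 <= n)%N)
  (A : {set F2pow n}) (hA : A \subset F2pow_pred n :\ 0)
  (hk : #|A| = k) (hk3 : (3 <= k)%N) (hr : (0 < rvalue A)%N) :
  exists B : {set F2pow n},
    [/\ B \subset [set: F2pow n] :\ 0,
        #|B| = (k + 3)%N
      & rvalue B = (rvalue A + 18)%N].
Proof.
pose i0 : 'I_n := Ordinal (ltnW hn).
have addFp (a : 'F_2) : a + a = 0 by rewrite addrr_pchar2 // pchar_Fp.
have addxx (x : F2pow n) : x + x = 0 by apply/rowP=> i; rewrite !mxE addFp.
pose f (x : F2pow n) := x 0 i0 != 0.
have fD : {morph f : x y / x + y >-> x (+) y}.
  move=> x y; rewrite /f mxE.
  by case: (x 0 i0) (y 0 i0) => [[|[|?]] ?] [[|[|?]] ?].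
have A0 : 0 \notin A by apply/negP=> /(subsetP hA); rewrite !inE eqxx.
have fA : {in A, forall a, ~~ f a}.
  move=> a /(subsetP hA); rewrite !inE => /andP[_ /forallP/(_ i0)].
  by rewrite /f negbK.
have f0 : f 0 = false by rewrite /f mxE eqxx.
have [[x y]] : exists p, p \in [set p in setX A A | p.1 + p.2 \in A].
  by apply/card_gt0P.
rewrite !inE /= => /andP[/andP[Ax Ay] Axy].
have x0 : x != 0 by apply: contraNneq A0 => <-.
have y0 : y != 0 by apply: contraNneq A0 => <-.
have xy : x != y by apply: contraNneq A0 => xy; rewrite -(addxx y) -{1}xy.
pose e : F2pow n := delta_mx 0 i0.
have fe : f e by rewrite /f mxE !eqxx.
pose S := [set e; e + x; e + y].
have fS : {in S, forall s, f s}.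
  by move=> s; rewrite !inE => /orP[/orP[]|] /eqP->;
    rewrite ?fD fe ?(negbTE (fA _ _)).
have cardS : #|S| = 3.
  rewrite /S -setUA cardsU1 cards2 !inE (inj_eq (addrI e)) xy.
  rewrite -![e == _](inj_eq (addrI e)) !addrA !addxx !add0r.
  by rewrite ![0 == _]eq_sym (negbTE x0) (negbTE y0).
have addeK (u : F2pow n) : e + (e + u) = u by rewrite addrA addxx add0r.
have SA : {in S &, forall s t, s != t -> s + t \in A}.
  have exey : (e + x) + (e + y) = x + y by rewrite addrACA addxx add0r.
  move=> s t; rewrite !inE.
  by case/orP=> [/orP[]|] /eqP -> /orP[/orP[]|] /eqP ->;
    rewrite ?eqxx // => _; rewrite ?exey ?addeK // addrC ?exey ?addeK.
exists (A :|: S); split.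
- rewrite setTD subUset; apply/andP; split; apply/subsetP=> u; rewrite !inE.
    by move=> Au; apply: contraNneq A0 => <-.
  move=> Su; have : f u by apply: fS; rewrite !inE.
  by apply: contraTneq => ->; rewrite f0.
- rewrite cardsU hk cardS (_ : A :&: S = set0) ?cards0 ?subn0 //.
  by apply/setP=> u; rewrite !inE; apply/negP=> /andP[/fA fu Su];
    case/negP: fu; apply: fS; rewrite !inE.
- by rewrite (rvalueU_odd addxx fD A0 fA fS SA) cardS.
Qed.
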